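(* Let $M$ be a complete (pointed) metric space. Then the following are equivalent. (a) $\mathrm{SMA}(M)$ is not dense in $\mathrm{Lip}_0(M)$. (b) $M$ is bi-Lipschitz equivalent to a subset of $\mathbb{R}$ with positive Lebesgue measure. (c) $M$ admits a bi-Lipschitz embedding into $\mathbb{R}$ and $\mathcal{H}^1(M)>0$.
   Context: A pointed metric space is a metric space $(M,d)$ with a distinguished point denoted $0\in M$. $\mathrm{Lip}_0(M)$ is the Banach space of all Lipschitz functions $f:M\to\mathbb{R}$ with $f(0)=0$, with the Lipschitz norm $\|f\|=\sup_{p\neq q\in M}\frac{|f(p)-f(q)|}{d(p,q)}$. Density is with respect to this norm. For $f\in\mathrm{Lip}_0(M)$, the minimum modulus of $f$ is $m(f)=\inf_{p\neq q\in M}\frac{|f(p)-f(q)|}{d(p,q)}$. We say $f$ strongly attains its minimum if there are $p\neq q\in M$ with $\frac{|f(p)-f(q)|}{d(p,q)}=m(f)$. $\mathrm{SMA}(M)$ is the set of all $f\in \mathrm{Lip}_0(M)$ that strongly attain their minimum. A function $f\in\mathrm{Lip}_0(M)$ is a bi-Lipschitz embedding from $M$ into $\mathbb{R}$ if there are constants $C>c>0$ with $c\,d(p,q)\le |f(p)-f(q)|\le C\,d(p,q)$ for all $p,q\in M$; in this case $M$ is said to be bi-Lipschitz equivalent to $f(M)\subseteq\mathbb{R}$. $\mathcal{H}^1$ denotes the 1-dimensional Hausdorff measure. *)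

(* Defs.v *)
From HB Require Import structures.
From mathcomp Require Import all_boot all_order all_algebra.
From mathcomp Require Import all_classical all_reals all_analysis.
Import Order.TTheory GRing.Theory Num.Theory.
Import numFieldNormedType.Exports.

Set Implicit Arguments.
Unset Strict Implicit.
Unset Printing Implicit Defensive.

Local Open Scope classical_set_scope.
Local Open Scope ring_scope.

(* The distinguished point 0 of a pointed metric space is [point]. *)
#[short(type="pointedMetricType")]
HB.structure Definition PointedMetric (K : numDomainType) :=
  { M of Metric K M & isPointed M }.

#[short(type="completePointedMetricType")]
HB.structure Definition CompletePointedMetric (K : numDomainType) :=
  { M of Metric K M & Complete M }.

Section slopes.
Context {R : realType} {M : metricType R}.
Implicit Types f : M -> R.

Definition slope f (p q : M) : R := `|f p - f q| / mdist p q.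

Definition slopes f : set R :=
  [set slope f x.1 x.2 | x in [set x : M * M | x.1 != x.2]].

End slopes.

Section lip0_type.
Context {R : realType} (M : pointedMetricType R).

Definition lip0 : {pred M -> R} := [pred f : M -> R | `[<
  (exists L : R, forall p q, `|f p - f q| <= L * mdist p q) /\
  f point = 0 >]].

Lemma lip0_submod_closed : submod_closed lip0.
Proof.
split=> [|a f g]; rewrite !inE /=.
  by split=> //; exists 0 => p q; rewrite subrr normr0 mul0r.
move=> [[K hK] f0] [[L hL] g0]; split; last first.
  by rewrite !fctE f0 g0 addr0 scaler0.
exists (`|a| * K + L) => p q; rewrite !fctE opprD addrACA -scalerBr.
rewrite (le_trans (ler_normD _ _))// mulrDl lerD// normrZ -mulrA.
by rewrite ler_wpM2l.
Qed.

HB.instance Definition _ := GRing.isSubmodClosed.Build R (M -> R) lip0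
  lip0_submod_closed.

Record Lip0 := MkLip0 { lip0_fun :> M -> R; lip0_funP : lip0_fun \in lip0 }.

HB.instance Definition _ := [isSub for lip0_fun].
HB.instance Definition _ := [Choice of Lip0 by <:].
HB.instance Definition _ := [SubChoice_isSubLmodule of Lip0 by <:].

End lip0_type.

Section lip0_norm.
Context {R : realType} (M : pointedMetricType R).
Implicit Types f g : Lip0 M.

(* On a one-point space this is [sup set0 = 0]. *)
Definition lip_norm f : R := sup (slopes f).

Lemma has_ubound_slopes f : has_ubound (slopes f).
Proof.
have := lip0_funP f; rewrite inE => -[[L hL] _].
exists L => _ [[p q] /= pq <-].
by rewrite /slope ler_pdivrMr ?hL// mdist_gt0.
Qed.

Lemma slope_le_lip_norm f p q : p != q -> slope f p q <= lip_norm f.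
Proof.
by move=> pq; apply: ub_le_sup; [exact: has_ubound_slopes|exists (p, q)].
Qed.

Lemma lip_norm_ge0 f : 0 <= lip_norm f.
Proof.
have [[x Sx]|S0] := pselect (slopes f !=set0).
  apply: le_trans (ub_le_sup (has_ubound_slopes f) Sx).
  by case: Sx => [[p q] _ <-]; rewrite divr_ge0// mdist_ge0.
by rewrite /lip_norm sup_out// => -[].
Qed.

Lemma lip_norm_le f (c : R) : 0 <= c ->
  (forall p q, p != q -> slope f p q <= c) -> lip_norm f <= c.
Proof.
move=> c0 fc; have [S0|S0] := pselect (slopes f !=set0).
  by apply: ge_sup => // _ [[p q] /= pq <-]; exact: fc.
by rewrite /lip_norm sup_out// => -[].
Qed.

Lemma ler_lip_normD f g : lip_norm (f + g) <= lip_norm f + lip_norm g.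
Proof.
apply: lip_norm_le => [|p q pq]; first by rewrite addr_ge0// lip_norm_ge0.
apply: (le_trans _ (lerD (slope_le_lip_norm f pq) (slope_le_lip_norm g pq))).
rewrite /slope -mulrDl ler_pM2r ?invr_gt0 ?mdist_gt0//=.
by rewrite !fctE opprD addrACA ler_normD.
Qed.

Let lip_normZ_le (a : R) f : lip_norm (a *: f) <= `|a| * lip_norm f.
Proof.
apply: lip_norm_le => [|p q pq]; first by rewrite mulr_ge0// lip_norm_ge0.
apply: (le_trans _ (ler_wpM2l (normr_ge0 a) (slope_le_lip_norm f pq))).
by rewrite /slope /= !fctE -scalerBr normrZ mulrA.
Qed.

Lemma lip_normZ (a : R) f : lip_norm (a *: f) = `|a| * lip_norm f.
Proof.
apply/eqP; rewrite eq_le lip_normZ_le/=.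
have [->|a0] := eqVneq a 0; first by rewrite normr0 mul0r lip_norm_ge0.
rewrite -ler_pdivlMl ?normr_gt0// -normfV.
by rewrite -{1}(scalerK a0 f) lip_normZ_le.
Qed.

Lemma lip_norm0_eq0 f : lip_norm f = 0 -> f = 0.
Proof.
move=> f0; apply/val_inj/funext => p /=.
have := lip0_funP f; rewrite inE => -[_ fpt].
have [->|ppt] := eqVneq p point; first by rewrite fpt.
have := slope_le_lip_norm f ppt.
rewrite f0 /slope fpt subr0 pmulr_lle0 ?invr_gt0 ?mdist_gt0//.
by rewrite normr_le0 => /eqP.
Qed.

HB.instance Definition _ := Lmodule_isNormed.Build R (Lip0 M)
  ler_lip_normD lip_normZ lip_norm0_eq0.

End lip0_norm.

Section notions.
Context {R : realType} (M : pointedMetricType R).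

Definition min_modulus (f : Lip0 M) : R := inf (slopes f).

Definition strongly_attains_min (f : Lip0 M) : Prop :=
  exists p q : M, p != q /\ slope f p q = min_modulus f.

Definition SMA : set (Lip0 M) := [set f | strongly_attains_min f].

Definition bilipschitz_embedding (f : Lip0 M) : Prop :=
  exists c C : R, [/\ 0 < c, c < C & forall p q : M,
    c * mdist p q <= `|f p - f q| /\ `|f p - f q| <= C * mdist p q].

Definition bilipschitz_equivalent (A : set R) : Prop :=
  exists f : Lip0 M, bilipschitz_embedding f /\ range f = A.

End notions.
Arguments SMA {R} M _.
Arguments bilipschitz_equivalent {R} M A.

(* The Caratheodory sigma-algebra of Lebesgue outer measure, which contains the
   Borel sets ([measurable]) strictly. *)
Definition lebesgue_measurable {R : realType} (A : set R) : Prop :=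
  ((wlength (R := R) idfun)^*%mu).-cara.-measurable A.

Section hausdorff.
Context {R : realType} {M : metricType R}.
Local Open Scope ereal_scope.

(* Adjoining 0 only serves to give the empty set diameter 0. *)
Definition diam (A : set M) : \bar R :=
  ereal_sup (0 |` [set (mdist x.1 x.2)%:E | x in A `*` A]).

Definition hausdorff1_premeasure (delta : R) (A : set M) : \bar R :=
  ereal_inf [set \sum_(0 <= k <oo) diam (U k) | U in
    [set U : nat -> set M |
      A `<=` \bigcup_k U k /\ forall k, diam (U k) <= delta%:E]].

Definition hausdorff1 (A : set M) : \bar R :=
  ereal_sup [set hausdorff1_premeasure delta A | delta in
    [set delta : R | (0 < delta)%R]].

End hausdorff.

(* Main.v *)
Require Import Defs.
From HB Require Import structures.
From mathcomp Require Import all_boot all_order all_algebra.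
From mathcomp Require Import all_classical all_reals all_analysis.
From mathcomp Require Import measurable_realfun ring lra.
Import Order.TTheory GRing.Theory Num.Theory.
Import numFieldNormedType.Exports.

Set Implicit Arguments.
Unset Strict Implicit.
Unset Printing Implicit Defensive.

Local Open Scope classical_set_scope.
Local Open Scope ring_scope.

(* Not (b) implies not (a).  If the slopes of f come arbitrarily close to 0, a
   small multiple of a distance function subtracted from f makes a slope vanish.
   Otherwise f embeds M onto a closed set A; suppose A is null.  Then any two
   points of A are joined, up to null measure, by gaps of A (pairs of consecutive
   points), so by the triangle inequality the slopes over gaps already have
   infimum m(f).  Shrinking f by the factor 1 - s on a gap of slope < (1 + s) m(f)
   leaves only the pairs around that gap within a bounded window as candidates
   for the minimum, and these form a compact set on which slopes are continuous.

   (b) implies (a).  Let E be a nowhere dense closed subset of positive measure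
   of the range A of an embedding e, and let F be e followed by a function of
   slope 1 on E and of large slope K off E.  If some g close to F attained its
   minimum at p, q, the triangle inequality would force every pair between p and q
   to attain it too, in particular a pair enclosing a component of the complement
   of E, whose slope is of order K.  But m(g) is at most of order 1, because E
   has density close to 1 in some interval with endpoints in E. *)

(** * The distribution function of Lebesgue measure on a set *)

Section cumulative_measure.
Context {R : realType}.
Implicit Types (S : set R) (x y : R).

Lemma lebesgue_measure_bounded_lty S x y : measurable S -> S `<=` `[x, y] ->
  (lebesgue_measure S < +oo)%E.
Proof.
move=> mS Sxy; apply: (@le_lt_trans _ _ (lebesgue_measure `[x, y])).
  by apply: le_measure; rewrite ?inE.
by rewrite lebesgue_measure_itv/=; case: ifP => _; rewrite ?ltry// -EFinB ltry.
Qed.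

(** [fine] loses nothing when [S] has finite measure, as the lemmas on increments assume. *)
Definition cumul S x : R := fine (lebesgue_measure (S `&` `]-oo, x])).

Lemma cumulB S x y : measurable S -> (lebesgue_measure S < +oo)%E -> x <= y ->
  (cumul S y - cumul S x)%:E = lebesgue_measure (S `&` `]x, y]).
Proof.
move=> mS Soo xy.
have fS B : measurable B -> lebesgue_measure (S `&` B) \is a fin_num.
  move=> mB; rewrite ge0_fin_numE//; apply: le_lt_trans Soo.
  by apply: le_measure; rewrite ?inE//; exact: measurableI.
rewrite EFinB !fineK ?fS//.
have -> : S `&` `]-oo, y] = (S `&` `]-oo, x]) `|` (S `&` `]x, y]).
  rewrite -setIUr; congr (_ `&` _); apply/seteqP; split=> t /=.
    by rewrite !in_itv/=; case: (leP t x) => tx ty; [left|right].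
  by rewrite !in_itv/= => -[tx|/andP[]//]; exact: le_trans xy.
rewrite measureU//=; try exact: measurableI.
  by rewrite addeAC subee ?add0e// fS.
apply/seteqP; split=> // t [[_ /=]]; rewrite !in_itv/= => tx [_ /andP[xt _]].
by move: (le_lt_trans tx xt); rewrite ltxx.
Qed.

Lemma ler_cumul S x y : measurable S -> (lebesgue_measure S < +oo)%E ->
  x <= y -> cumul S x <= cumul S y.
Proof. by move=> mS Soo xy; rewrite -subr_ge0 -lee_fin cumulB. Qed.

Lemma cumulB_le S x y : measurable S -> (lebesgue_measure S < +oo)%E ->
  x <= y -> cumul S y - cumul S x <= y - x.
Proof.
move=> mS Soo xy; rewrite -lee_fin cumulB//.
apply: (@le_trans _ _ (lebesgue_measure `]x, y])).
  by apply: le_measure; rewrite ?inE//; exact: measurableI.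
by rewrite lebesgue_measure_itv/= lte_fin; case: ifPn => //; rewrite lee_fin subr_ge0.
Qed.

Lemma cumulB_full S x y : measurable S -> (lebesgue_measure S < +oo)%E ->
  x < y -> `]x, y] `<=` S -> cumul S y - cumul S x = y - x.
Proof.
move=> mS Soo xy xyS; apply: EFin_inj; rewrite cumulB ?ltW// setIidr//.
by rewrite lebesgue_measure_itv/= lte_fin xy.
Qed.

Lemma cumulB_gap S x y : measurable S -> (lebesgue_measure S < +oo)%E ->
  x <= y -> (forall t, S t -> ~ (x < t < y)) -> cumul S y - cumul S x = 0.
Proof.
move=> mS Soo xy gap; apply: EFin_inj; rewrite cumulB//.
apply/eqP; rewrite eq_le measure_ge0 andbT.
(* The half-open interval can still meet [S] at its right endpoint, a null set. *)
apply: (@le_trans _ _ (lebesgue_measure [set y])); last first.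
  by rewrite lebesgue_measure_set1.
apply: le_measure; rewrite ?inE//; first exact: measurableI.
move=> t [St /=]; rewrite in_itv/= => /andP[xt]; rewrite le_eqVlt.
by case/orP => [/eqP//|ty]; case: (gap _ St); rewrite xt.
Qed.

Lemma cumulB_le_measure S x y : measurable S -> (lebesgue_measure S < +oo)%E ->
  x <= y -> cumul S y - cumul S x <= fine (lebesgue_measure S).
Proof.
move=> mS Soo xy; rewrite -lee_fin cumulB// fineK ?ge0_fin_numE//.
by apply: le_measure; rewrite ?inE//; exact: measurableI.
Qed.

End cumulative_measure.

(** * Closed subsets of the line and their gaps *)

Section gaps.
Context {R : realType}.
Implicit Types (A : set R) (D : R -> R -> R) (w : R -> R).

Lemma closed_approx A x : closed A ->
  (forall e, 0 < e -> exists2 y, A y & `|x - y| < e) -> A x.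
Proof.
move=> cA xA; apply: cA => B /nbhs_ballP[e e0 eB].
by have [y Ay xy] := xA e e0; exists y; split=> //; exact: eB.
Qed.

Lemma closed_inf A B : closed A -> B `<=` A -> has_inf B -> A (inf B).
Proof.
move=> cA BA infB; apply: closed_approx => // e e0.
have [t Bt te] := inf_adherent e0 infB; exists t; first exact: BA.
have := ge_inf infB.2 Bt; rewrite ltr_norml; lra.
Qed.

Lemma closed_sup A B : closed A -> B `<=` A -> has_sup B -> A (sup B).
Proof.
move=> cA BA supB; apply: closed_approx => // e e0.
have [t Bt te] := sup_adherent e0 supB; exists t; first exact: BA.
have := ub_le_sup supB.2 Bt; rewrite ltr_norml; lra.
Qed.

Definition is_gap A x y := [/\ A x, A y, x < y & forall t, A t -> ~ (x < t < y)].

(** Consider the infimum of the points of [A] beyond [x]. Either it is [x], and points of [A]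
    accumulate at [x] from the right, or it is the right end of a gap starting at [x]. *)
Lemma closed_succ A x q r : closed A -> A x -> A q -> x < q -> 0 < r ->
  (exists y, [/\ A y, x < y <= q & y < x + r]) \/
  (exists2 y, is_gap A x y & y <= q).
Proof.
move=> cA Ax Aq xq r0; pose B := [set t | A t /\ x < t].
have Bq : B q by [].
have lB : lbound B x by move=> t [_ /ltW].
have infB : has_inf B by split; [exists q|exists x].
have xB : x <= inf B by apply: lb_le_inf => //; exists q.
have [e e0 he] : exists2 e, 0 < e & e <= r /\ e <= q - x.
  exists (Num.min r (q - x)); first by rewrite lt_min r0 subr_gt0.
  by split; rewrite ge_min lexx ?orbT.
move: xB; rewrite le_eqVlt => /orP[/eqP xE|xB].
  left; have [t [At xt]] := inf_adherent e0 infB.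
  by rewrite -xE => te; exists t; split=> //; lra.
right; exists (inf B); last exact: (ge_inf infB.2 Bq).
split=> //; first by apply: closed_inf => // t [].
move=> t At /andP[xt tB]; have : inf B <= t by apply: (ge_inf infB.2).
by rewrite leNgt tB.
Qed.

(* Real induction along A: the set of the t such that D p t <= w t - w p is
   closed on the left because D is Lipschitz. *)
Lemma telescope A D w C p q : closed A -> A p -> A q -> p <= q -> 0 <= C ->
  (forall x y z, A x -> A y -> A z -> x <= y <= z -> D x z <= D x y + D y z) ->
  (forall x y, A x -> A y -> x <= y -> D x y <= C * (y - x)) ->
  {homo w : x y / x <= y} ->
  (forall x, A x -> p <= x < q ->
    exists y, [/\ A y, x < y <= q & D x y <= w y - w x]) ->
  D p q <= w q - w p.
Proof.
move=> cA Ap Aq pq C0 Dtri Dlip wnd step.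
pose S := [set t | [/\ A t, p <= t <= q & D p t <= w t - w p]].
have Sp : S p.
  split=> //; first by rewrite lexx.
  by rewrite subrr (le_trans (Dlip _ _ Ap Ap (lexx _)))// subrr mulr0.
have supS : has_sup S by split; [exists p|exists q => t [_ /andP[]]].
set s := sup S.
have As : A s by apply: closed_sup supS => // t [].
have ps : p <= s by exact: (ub_le_sup supS.2 Sp).
have sq : s <= q by apply: ge_sup; [exists p|move=> t [_ /andP[]]].
have Ds : D p s <= w s - w p.
  apply/ler_addgt0Pr => e e0.
  have e1 : 0 < e / (C + 1) by rewrite divr_gt0// ltr_wpDl.
  have [t St te] := sup_adherent e1 supS.
  have ts : t <= s by exact: (ub_le_sup supS.2 St).
  case: St => At /andP[pt tq] Dt.
  have ptz : p <= t <= s by rewrite pt.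
  have := Dtri _ _ _ Ap At As ptz; have := Dlip _ _ At As ts; have := wnd _ _ ts.
  have : C * (s - t) <= e.
    apply: (@le_trans _ _ ((C + 1) * (e / (C + 1)))); last first.
      by rewrite mulrC divfK// gt_eqF// ltr_wpDl.
    by apply: ler_pM => //; rewrite ?subr_ge0 ?lerDl//; move: te; rewrite -/s; lra.
  lra.
move: sq; rewrite le_eqVlt => /orP[/eqP <-//|sq].
have psq : p <= s < q by rewrite ps.
have [y [Ay /andP[sy yq] Dsy]] := step _ As psq.
have : y <= s.
  apply: (ub_le_sup supS.2); split=> //; first by rewrite (le_trans ps (ltW sy)).
  have psy : p <= s <= y by rewrite ps ltW.
  by have := Dtri _ _ _ Ap As Ay psy; lra.
by rewrite leNgt sy.
Qed.

(* Take w t = s * t + C * lambda(U `&` ]-oo, t]) in telescope, with U open around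
   A `&` [p, q]: each step either is a gap of A or stays inside U. *)
Lemma gap_estimate A D s C p q : closed A -> A p -> A q -> p <= q ->
  0 <= s -> 0 <= C ->
  (forall x y z, A x -> A y -> A z -> x <= y <= z -> D x z <= D x y + D y z) ->
  (forall x y, A x -> A y -> x <= y -> D x y <= C * (y - x)) ->
  (forall x y, is_gap A x y -> D x y <= s * (y - x)) ->
  D p q <= s * (q - p) + C * fine (lebesgue_measure (A `&` `[p, q])).
Proof.
move=> cA Ap Aq pq s0 C0 Dtri Dlip Dgap.
set B := A `&` `[p, q].
have mB : measurable B by apply: measurableI => //; exact: closed_measurable.
have Boo := lebesgue_measure_bounded_lty mB (@subIsetr _ _ _).
apply/ler_addgt0Pr => e e0.
have e1 : 0 < e / (C + 1) by rewrite divr_gt0// ltr_wpDl.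
have [U [oU BU UB]] := lebesgue_regularity_outer mB Boo e1.
have mU : measurable U by exact: open_measurable.
have UE : lebesgue_measure U = (lebesgue_measure B + lebesgue_measure (U `\` B))%E.
  rewrite (measureDI lebesgue_measure mU mB) addeC (setIidr BU)//.
have UBoo : (lebesgue_measure (U `\` B) < +oo)%E by rewrite (lt_trans UB)// ltry.
have Uoo : (lebesgue_measure U < +oo)%E by rewrite UE lte_add_pinfty.
have fU : fine (lebesgue_measure U) <= fine (lebesgue_measure B) + e / (C + 1).
  rewrite -lee_fin EFinD !fineK ?ge0_fin_numE//.
  by rewrite UE leeD2l// ltW.
pose w t := s * t + C * cumul U t.
have wnd : {homo w : x y / x <= y}.
  by move=> x y xy; apply: lerD; apply: ler_wpM2l => //; exact: ler_cumul.
have step x : A x -> p <= x < q ->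
    exists y, [/\ A y, x < y <= q & D x y <= w y - w x].
  move=> Ax /andP[px xq].
  have Ux : U x by apply: BU; split=> //=; rewrite in_itv/= px ltW.
  have [r /= r0 rU] : exists2 r, 0 < r & ball x r `<=` U.
    by apply/nbhs_ballP; exact: open_nbhs_nbhs.
  have [[y [Ay /andP[xy yq] yr]]|[y gxy yq]] := closed_succ cA Ax Aq xq r0.
    exists y; split=> //; first by rewrite xy.
    (* As [y < x + r], all of []x, y]] lies in [U], so the term [C * cumul U] of [w] alone pays for
       the Lipschitz bound on [D x y]. *)
    have cU : cumul U y - cumul U x = y - x.
      apply: cumulB_full => // t /=; rewrite in_itv/= => /andP[xt ty].
      by apply: rU; rewrite /ball/= ltr_norml; lra.
    have sxy : 0 <= s * (y - x) by rewrite mulr_ge0// subr_ge0 ltW.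
    by have := Dlip _ _ Ax Ay (ltW xy); rewrite -cU /w; lra.
  case: (gxy) => _ Ay xy _; exists y; split=> //; first by rewrite xy.
  have := Dgap _ _ gxy.
  have : 0 <= C * (cumul U y - cumul U x).
    by rewrite mulr_ge0// subr_ge0 ler_cumul// ltW.
  by rewrite /w; lra.
have := telescope cA Ap Aq pq C0 Dtri Dlip wnd step.
have : C * (cumul U q - cumul U p) <= C * (fine (lebesgue_measure B) + e / (C + 1)).
  by apply: ler_wpM2l => //; apply: le_trans fU; exact: cumulB_le_measure.
have : C * (e / (C + 1)) <= e.
  rewrite mulrCA ger_pMr// ler_pdivrMr ?ltr_wpDl//; lra.
by rewrite /w; lra.
Qed.

End gaps.

(** * Nowhere dense sets of positive measure and a stretching function *)

Section stretch.
Context {R : realType}.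
Implicit Types (A E : set R).

(** By countable subadditivity some truncation of [A] to [[-n, n]] has positive measure. An open set
    around the rationals of smaller measure cannot exhaust it, and removing that set leaves no
    interval. *)
Lemma fat_nowhere_dense A : closed A -> (0 < lebesgue_measure A)%E ->
  exists E n, [/\ closed E, E `<=` A `&` `[- n%:R, n%:R],
    (0 < lebesgue_measure E)%E &
    forall x y, x < y -> exists2 t, x < t < y & ~ E t].
Proof.
move=> cA A0; pose B (n : nat) := A `&` `[- n%:R, n%:R].
have cB n : closed (B n) by apply: closedI => //; exact: interval_closed.
have mB n : measurable (B n) by exact: closed_measurable.
have [n Bn0] : exists n, (0 < lebesgue_measure (B n))%E.
  apply: contrapT => /forallNP B0; move: A0; apply/negP; rewrite -leNgt.
  have -> : A = \bigcup_n B n by rewrite -setI_bigcupr bigcup_itvT setIT.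
  have mUB : measurable (\bigcup_k B k) by exact: bigcupT_measurable.
  apply: le_trans
    (measure_sigma_subadditive lebesgue_measure mB mUB (@subset_refl _ _)) _.
  rewrite eseries0// => i _ _.
  by apply/eqP; rewrite eq_le measure_ge0 andbT leNgt; exact/negP/B0.
have mBn := mB n.
have fB : lebesgue_measure (B n) \is a fin_num.
  rewrite ge0_fin_numE//.
  exact: lebesgue_measure_bounded_lty mBn (@subIsetr _ _ _).
pose Q : set R := @ratr R @` setT.
have mQ : measurable Q.
  have -> : Q = \bigcup_q [set ratr q].
    by apply/seteqP; split=> [_ [q _ <-]|_ [q _ ->]]; exists q.
  exact: bigcupT_measurable_rat.
have Q0 : lebesgue_measure Q = 0%E by exact: lebesgue_measure_rat.
have Qoo : (lebesgue_measure Q < +oo)%E by rewrite Q0.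
have b0 : 0 < fine (lebesgue_measure (B n)).
  by rewrite fine_gt0// Bn0/= -ge0_fin_numE.
have [U [oU QU UQ]] := lebesgue_regularity_outer mQ Qoo b0.
have mU : measurable U by exact: open_measurable.
rewrite fineK// in UQ.
exists (B n `\` U), n; split.
- by apply: closedI => //; exact: open_closedC.
- exact: subDsetl.
- have BE : lebesgue_measure (B n) =
      (lebesgue_measure (B n `\` U) + lebesgue_measure (B n `&` U))%E.
    exact: measureDI.
  have BU : (lebesgue_measure (B n `&` U) < lebesgue_measure (B n))%E.
    apply: le_lt_trans UQ.
    apply: (@le_trans _ _ (lebesgue_measure U)).
      by apply: le_measure; rewrite ?inE//; exact: measurableI.
    by rewrite (measureDI lebesgue_measure mU mQ) (setIidr QU) [X in (_ + X)%E]Q0 adde0//.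
  rewrite lt_neqAle measure_ge0 andbT; apply/eqP => B0.
  by move: BU; rewrite BE -B0 add0e ltxx.
- move=> x y xy.
  have [t [xty Qt]] : (`]x, y[ `&` Q) !=set0.
    apply: dense_rat; last exact: interval_open.
    exists ((x + y) / 2); rewrite /= in_itv/= !midf_lt//.
  exists t; first by move: xty; rewrite /= in_itv.
  by case=> _; apply; exact: QU.
Qed.

(** A weak density theorem. If every pair in [E] had density below [1 - th], then [gap_estimate] for
    the increments of [cumul E], with slope 0 on gaps and Lipschitz constant [1 - th], taken between
    [inf E] and [sup E], would bound the measure of [E] by [1 - th] times itself. *)
Lemma dense_pair E n (th : R) : closed E -> E `<=` `[- n%:R, n%:R] ->
  (0 < lebesgue_measure E)%E -> 0 < th <= 1 ->
  exists x y, [/\ E x, E y, x < y &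
    (1 - th) * (y - x) <= cumul E y - cumul E x].
Proof.
move=> cE En E0 /andP[th0 th1]; apply: contrapT => noxy.
have mE : measurable E by exact: closed_measurable.
have Eoo := lebesgue_measure_bounded_lty mE En.
have [z Ez] : E !=set0.
  apply/set0P/eqP => E00; by rewrite E00 measure0 ltxx in E0.
have infE : has_inf E.
  split; [by exists z|exists (- n%:R) => t /En].
  by rewrite /= in_itv/= => /andP[].
have supE : has_sup E.
  split; [by exists z|exists n%:R => t /En].
  by rewrite /= in_itv/= => /andP[].
have Ep := closed_inf cE (@subset_refl _ _) infE.
have Eq := closed_sup cE (@subset_refl _ _) supE.
set p := inf E in Ep; set q := sup E in Eq.
have pE t : E t -> p <= t by exact: ge_inf infE.2 t.
have Eqt t : E t -> t <= q by exact: ub_le_sup supE.2 t.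
have pq : p <= q by exact: pE.
have EI : E `&` `[p, q] = E.
  by apply: setIidl => t Et; rewrite /= in_itv/= pE// Eqt.
have := @gap_estimate _ E (fun x y => cumul E y - cumul E x) 0 (1 - th) p q cE Ep Eq pq.
rewrite subr_ge0 EI mul0r add0r lexx th1.
have -> : cumul E q - cumul E p = fine (lebesgue_measure E).
  have -> : lebesgue_measure E = (cumul E q - cumul E p)%:E; last by [].
  rewrite cumulB//.
  have E1 : E = (E `&` `]p, q]) `|` [set p].
    apply/seteqP; split=> t; last by case=> [[]//|->].
    move=> Et; case: (eqVneq t p) => [->|tp]; [by right|left].
    by split=> //=; rewrite in_itv/= lt_neqAle eq_sym tp pE//= Eqt.
  rewrite {1}E1 measureU//=.
  - by rewrite lebesgue_measure_set1 adde0.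
  - exact: measurableI.
  - apply/seteqP; split=> // t [[_ /=]]; rewrite in_itv/= => + tp.
    by rewrite tp ltxx.
have e0 : 0 < fine (lebesgue_measure E) by rewrite fine_gt0// E0.
move=> /(_ isT isT) H.
have : fine (lebesgue_measure E) <= (1 - th) * fine (lebesgue_measure E).
  apply: H.
  - by move=> x y t _ _ _ _; lra.
  - move=> x y Ex Ey; rewrite le_eqVlt => /orP[/eqP ->|xy].
      by rewrite !subrr mulr0.
    rewrite leNgt; apply/negP => /ltW h; apply: noxy.
    by exists x, y.
  - by move=> x y [_ _ xy gxy]; rewrite mul0r cumulB_gap// ltW.
have : 0 < th * fine (lebesgue_measure E) by rewrite mulr_gt0.
lra.
Qed.

(** The endpoints are the nearest points to [t] on either side in [E] with [p] and [q] adjoined;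
    adjoining them covers the case where [E] has no point between [t] and [p] or [q]. *)
Lemma gap_around E p q t : closed E -> p < t < q -> ~ E t ->
  exists x y, [/\ x < t < y, x = p \/ E x, y = q \/ E y, p <= x & y <= q] /\
    forall z, E z -> ~ (x < z < y).
Proof.
move=> cE /andP[pt tq] Et.
pose L := [set z | (z = p \/ E z) /\ p <= z <= t].
pose U := [set z | (z = q \/ E z) /\ t <= z <= q].
have Lp : L p by split; [left|rewrite lexx ltW].
have Uq : U q by split; [left|rewrite lexx ltW].
have supL : has_sup L by split; [exists p|exists t => z [_ /andP[]]].
have infU : has_inf U by split; [exists q|exists t => z [_ /andP[]]].
have cl a : closed [set z | z = a \/ E z].
  have -> : [set z | z = a \/ E z] = [set a] `|` E by [].
  by apply: closedU => //; exact: closed_eq.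
have Lx : [set z | z = p \/ E z] (sup L) by apply: closed_sup => // z [].
have Uy : [set z | z = q \/ E z] (inf U) by apply: closed_inf => // z [].
have px : p <= sup L by exact: (ub_le_sup supL.2).
have yq : inf U <= q by exact: (ge_inf infU.2).
have xt : sup L <= t by apply: ge_sup; [exists p|move=> z [_ /andP[]]].
have ty : t <= inf U by apply: lb_le_inf; [exists q|move=> z [_ /andP[]]].
exists (sup L), (inf U); split.
  split=> //; rewrite !lt_neqAle xt ty !andbT; apply/andP; split; apply/eqP.
    by move=> xE; case: Lx => [xp|]; [move: pt; rewrite -xE xp ltxx|rewrite xE].
  by move=> xE; case: Uy => [xp|]; [move: tq; rewrite xE xp ltxx|rewrite -xE].
move=> z Ez /andP[xz zy]; have [zt|/ltW tz] := leP z t.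
  have := xz; rewrite ltNge => /negP; apply; apply: (ub_le_sup supL.2).
  by split; [right|rewrite zt (le_trans px (ltW xz))].
have := zy; rewrite ltNge => /negP; apply; apply: (ge_inf infU.2).
by split; [right|rewrite tz (le_trans (ltW zy) yq)].
Qed.

(* phi has slope 1 on a nowhere dense E of positive measure and slope K off E. *)
Lemma stretch_function A (K : R) : closed A -> (0 < lebesgue_measure A)%E ->
  1 <= K -> exists phi : R -> R, [/\
    forall x y, x <= y -> y - x <= phi y - phi x <= K * (y - x),
    exists x y, [/\ A x, A y, x < y & phi y - phi x <= 2 * (y - x)] &
    forall p q, A p -> A q -> p < q -> exists x y,
      [/\ A x, A y, p <= x < y, y <= q & phi y - phi x = K * (y - x)]].
Proof.
move=> cA A0 K1; have [E [n [cE EA E0 Ed]]] := fat_nowhere_dense cA A0.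
have En : E `<=` `[- n%:R, n%:R] by move=> t /EA[].
have {}EA t : E t -> A t by move=> /EA[].
have mE : measurable E by exact: closed_measurable.
have Eoo := lebesgue_measure_bounded_lty mE En.
have K0 : 0 < K by lra.
exists (fun x => K * x - (K - 1) * cumul E x); split.
- move=> x y xy; have := ler_cumul mE Eoo xy; have := cumulB_le mE Eoo xy.
  by nra.
(* Density at least [1 - K^-1] gives [phi] slope at most [K - (K - 1) * (1 - K^-1) = 2 - K^-1]. *)
- have Ki : 0 < K^-1 <= 1 by rewrite invr_gt0 K0 invf_le1.
  have [x [y [Ex Ey xy Exy]]] := dense_pair cE En E0 Ki.
  exists x, y; split=> //; [exact: EA|exact: EA|].
  have : (K - 1) * ((1 - K^-1) * (y - x)) <= (K - 1) * (cumul E y - cumul E x).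
    by apply: ler_wpM2l => //; rewrite subr_ge0.
  have : K * K^-1 = 1 by rewrite divff// gt_eqF.
  have : 0 <= K^-1 * (y - x) by apply: mulr_ge0; rewrite ?invr_ge0 ?subr_ge0 ltW.
  set k := K^-1 => h1 h2.
  have -> : (K - 1) * ((1 - k) * (y - x)) =
    (K - 1 - K * k) * (y - x) + k * (y - x) by ring.
  by rewrite h2; nra.
(* The interval around a point [t] off [E] is cut at [p] and [q], so its endpoints stay in [A]. It
   carries no measure of [E], so only the term [K * x] of [phi] grows on it. *)
- move=> p q Ap Aq pq; have [t ptq nEt] := Ed _ _ pq.
  have [x [y [[/andP[xt ty] Ex Ey px yq] gxy]]] := gap_around cE ptq nEt.
  have xy : x < y by exact: lt_trans ty.
  exists x, y; split=> //.
  + by case: Ex => [->|/EA].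
  + by case: Ey => [->|/EA].
  + by rewrite px.
  + by have := cumulB_gap mE Eoo (ltW xy) gxy; nra.
Qed.

End stretch.

(** * Expanding maps, Lipschitz functions and slopes *)

Lemma closed_range_expanding (R : realType) (M : completePointedMetricType R)
    (e : M -> R) (c C : R) : 0 < c ->
  (forall p q, c * mdist p q <= `|e p - e q|) ->
  (forall p q, `|e p - e q| <= C * mdist p q) -> closed (range e).
Proof.
move=> c0 ce eC y ye.
(* The preimages of balls around the adherent point [y] generate a filter, which is Cauchy because
   [e] expands distances by [c]. Its limit exists by completeness and is mapped to [y] by
   continuity. *)
pose N (r : R) := [set p : M | `|y - e p| < r].
have N0 r : 0 < r -> N r !=set0.
  move=> r0; have [_ [[p _ <-]]] := ye _ (nbhsx_ballx y r r0).
  by exists p.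
pose F := filter_from [set r : R | 0 < r] N.
have FF : ProperFilter F.
  apply: filter_from_proper => //.
  apply: filter_from_filter; first by exists 1 => /=.
  move=> r s /= r0 s0; exists (Num.min r s); first by rewrite /= lt_min r0.
  by move=> p; rewrite /N /= lt_min => /andP[].
have cF : cauchy F.
  apply: cauchy_exP => r r0; have r1 : 0 < c * r / 2 by rewrite divr_gt0 ?mulr_gt0.
  have [p Np] := N0 _ r1; exists p, (c * r / 2) => // q Nq.
  rewrite ballEmdist /= -(ltr_pM2l c0) (le_lt_trans (ce _ _))//.
  rewrite -(subrK y (e p)) -addrA (le_lt_trans (ler_normD _ _))//.
  by rewrite distrC; move: Np Nq; rewrite /N/=; lra.
have := @cauchy_cvg M F FF cF; set x := lim F => Fx.
exists x => //; apply/eqP; rewrite -subr_eq0 -normr_eq0 eq_le normr_ge0 andbT.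
apply/ler_addgt0Pr => r r0; rewrite add0r.
have C0 : 0 < `|C| + 1 by rewrite ltr_wpDl.
have r1 : 0 < r / 2 / (`|C| + 1) by rewrite !divr_gt0.
have r2 : 0 < r / 2 by rewrite divr_gt0.
have [s /= s0 sx] := Fx _ (nbhsx_ballx x _ r1).
have [p] : N (Num.min s (r / 2)) !=set0 by apply: N0; rewrite lt_min s0.
rewrite /N /= lt_min => /andP[ps pr].
have := sx p ps; rewrite ballEmdist /= ltr_pdivlMr// => xp.
have h : C * mdist x p <= mdist x p * (`|C| + 1).
  rewrite mulrC ler_wpM2l ?mdist_ge0//; have := ler_norm C; lra.
rewrite -(subrK (e p) (e x)) -addrA (le_trans (ler_normD _ _))//.
by have := eC x p; rewrite (distrC (e p)); lra.
Qed.

Section lip0_aux.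
Context {R : realType} (M : pointedMetricType R).
Implicit Types (f g : Lip0 M) (p q x y : M).

Lemma mdist_diffl p q x : `|mdist p x - mdist q x| <= mdist p q.
Proof.
have := metric_triangle p q x; have := metric_triangle q p x.
by rewrite (metric_sym q p) ler_norml; lra.
Qed.

(** Slopes depend on differences only, so a Lipschitz function is normalised at the base point and
    then known through its differences alone. *)
Lemma lip0_of_lipschitz (h : M -> R) (L : R) :
  (forall p q, `|h p - h q| <= L * mdist p q) ->
  exists g, forall p q, g p - g q = h p - h q.
Proof.
move=> hL; have hP : (fun p => h p - h point) \in @lip0 R M.
  rewrite inE; split; last by rewrite subrr.
  by exists L => p q; rewrite opprB addrA subrK.
by exists (MkLip0 hP) => p q /=; rewrite opprB addrA subrK.
Qed.

Lemma lip0_dist_le f g (r : R) : 0 <= r ->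
  (forall p q, `|(f p - f q) - (g p - g q)| <= r * mdist p q) -> `|f - g| <= r.
Proof.
move=> r0 fg; apply: lip_norm_le => // p q pq.
rewrite /slope ler_pdivrMr ?mdist_gt0//; apply: le_trans (fg p q).
by rewrite /= !fctE /= le_eqVlt; apply/orP; left; apply/eqP; congr (`| _ |); ring.
Qed.

Lemma lip0_diff_le f p q : `|f p - f q| <= `|f| * mdist p q.
Proof.
have [->|pq] := eqVneq p q; first by rewrite subrr normr0 mulr_ge0 ?mdist_ge0.
by rewrite -ler_pdivrMr ?mdist_gt0//; exact: slope_le_lip_norm.
Qed.

Lemma lip0_dist_ge f g p q :
  `|(f p - f q) - (g p - g q)| <= `|f - g| * mdist p q.
Proof.
apply: le_trans (lip0_diff_le (f - g) p q).
by rewrite /= !fctE /= le_eqVlt; apply/orP; left; apply/eqP; congr (`| _ |); ring.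
Qed.

Lemma slope_ge0 (f : M -> R) p q : 0 <= slope f p q.
Proof. by rewrite divr_ge0 ?mdist_ge0. Qed.

Lemma slopeC (f : M -> R) p q : slope f p q = slope f q p.
Proof. by rewrite /slope distrC metric_sym. Qed.

Lemma slopeM (f : M -> R) p q : slope f p q * mdist p q = `|f p - f q|.
Proof.
have [->|pq] := eqVneq p q; first by rewrite mdistxx mulr0 subrr normr0.
by rewrite divfK// gt_eqF// mdist_gt0.
Qed.

Lemma has_lbound_slopes f : has_lbound (slopes f).
Proof. by exists 0 => _ [[p q] _ <-]; exact: slope_ge0. Qed.

Lemma min_modulus_le f p q : p != q -> min_modulus f <= slope f p q.
Proof. by move=> pq; apply: (ge_inf (has_lbound_slopes f)); exists (p, q). Qed.

Lemma strongly_attains_minP f p q : p != q ->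
  (forall x y, x != y -> slope f p q <= slope f x y) -> SMA M f.
Proof.
move=> pq fpq; exists p, q; split=> //; apply/eqP.
rewrite eq_le min_modulus_le// andbT.
by apply: lb_le_inf => [|_ [[x y] /= xy <-]]; [exists (slope f p q), (p, q)|exact: fpq].
Qed.

(** With [k] the signed slope at [(p, q)], subtracting [k] times the distance to [q] equalises the
    values at [p] and [q]. The slope 0, the least possible, is then attained, and the change has
    norm at most [r] since distance functions are 1-Lipschitz. *)
Lemma SMA_approx_small_slope f (r : R) p q : p != q -> slope f p q <= r ->
  exists2 g, SMA M g & `|f - g| <= r.
Proof.
move=> pq fr; have d0 : 0 < mdist p q by rewrite mdist_gt0.
pose k := (f p - f q) / mdist p q.
have kE : `|k| = slope f p q by rewrite /k normrM normfV (gtr0_norm d0).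
have kd x y : `|k * mdist x q - k * mdist y q| <= `|k| * mdist x y.
  by rewrite -mulrBr normrM ler_wpM2l// mdist_diffl.
have [x y|g gE] := @lip0_of_lipschitz (fun x => f x - k * mdist x q) (`|f| + `|k|).
  rewrite opprD addrACA mulrDl (le_trans (ler_normD _ _))// lerD ?lip0_diff_le//.
  by rewrite opprK addrC distrC.
exists g.
  apply: (strongly_attains_minP pq) => x y xy.
  rewrite {1}/slope gE mdistxx mulr0 subr0 /k divfK ?gt_eqF//.
  by rewrite addrAC subrr normr0 mul0r slope_ge0.
apply: lip0_dist_le => [|x y]; first exact: le_trans (slope_ge0 _ _ _) fr.
rewrite gE; apply: le_trans (ler_wpM2r (mdist_ge0 _ _) fr); rewrite -kE.
apply: le_trans (kd x y); rewrite le_eqVlt; apply/orP; left; apply/eqP.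
by congr (`| _ |); ring.
Qed.

End lip0_aux.

(** * Positive measure of the range obstructs density *)

Lemma not_dense_SMA (R : realType) (M : completePointedMetricType R)
    (e : Lip0 M) (c C : R) : 0 < c -> c <= C ->
  (forall p q, c * mdist p q <= `|e p - e q|) ->
  (forall p q, `|e p - e q| <= C * mdist p q) ->
  (0 < lebesgue_measure (range e))%E -> ~ dense (SMA M).
Proof.
move=> c0 cC ce eC e0.
have cle : closed (range e) by exact: closed_range_expanding ce eC.
(* With this [K], any [g] within [c / 2] of [F] has slope at least
   [K * c - c / 2 = 2 * C + 3 * c / 2] where [phi] has slope [K], which exceeds the bound
   [2 * C + c / 2] on the minimum modulus proved in [m_le]. *)
pose K := 2 * (C + c) / c.
have Kc : K * c = 2 * (C + c) by rewrite /K divfK// gt_eqF.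
have K1 : 1 <= K by rewrite /K ler_pdivlMr//; lra.
have [phi [phiK [_ [_ [[x1 _ <-] [y1 _ <-] xy1 phi1]]] phi2]] :=
  stretch_function cle e0 K1.
have phi_lip s t : `|phi s - phi t| <= K * `|s - t|.
  wlog st : s t / s <= t.
    move=> H; have [|/ltW] := leP s t; first exact: H.
    by rewrite distrC (distrC s); exact: H.
  have := phiK _ _ st; rewrite (distrC (phi s)) (distrC s).
  rewrite (@ger0_norm _ (t - s)) ?subr_ge0// => /andP[h1 h2].
  by rewrite ger0_norm//; lra.
have [p q|F FE] := @lip0_of_lipschitz _ M (phi \o e) (K * C).
  rewrite /= (le_trans (phi_lip _ _))// -mulrA ler_wpM2l//; lra.
move=> dS; have r0 : 0 < c / 2 by lra.
have [g [/= gF [p0 [q0 [pq0 m0]]]]] : (ball F (c / 2) `&` SMA M) !=set0.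
  by apply: dS; [exists F; exact: ballxx|exact: ball_open].
have {}gF x y : `|(F x - F y) - (g x - g y)| <= c / 2 * mdist x y.
  apply: (le_trans (lip0_dist_ge _ _ _ _)); rewrite ler_wpM2r ?mdist_ge0//.
  by rewrite ltW//; move: gF; rewrite -ball_normE.
have gF1 x y : F y - F x - c / 2 * mdist x y <= g y - g x.
  by have := gF x y; rewrite ler_norml => /andP[]; lra.
have gF2 x y : g y - g x <= F y - F x + c / 2 * mdist x y.
  by have := gF x y; rewrite ler_norml => /andP[]; lra.
have ce1 x y : e x <= e y -> c * mdist x y <= e y - e x <= C * mdist x y.
  move=> xy; have := ce x y; have := eC x y.
  by rewrite distrC ger0_norm ?subr_ge0// => -> ->.
have g_ge0 x y : e x <= e y -> 0 <= g y - g x.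
  move=> xy; have /andP[h1 h2] := ce1 _ _ xy; have /andP[h3 h4] := phiK _ _ xy.
  have := gF1 x y; rewrite FE /=; have := mdist_ge0 x y; nra.
have [p [q [pq m_pq]]] : exists p q, e p < e q /\ slope g p q = min_modulus g.
  have : e p0 != e q0.
    rewrite -subr_eq0 -normr_gt0; apply: lt_le_trans (ce _ _).
    by rewrite mulr_gt0// mdist_gt0.
  rewrite neq_lt => /orP[h|h]; first by exists p0, q0.
  by exists q0, p0; rewrite slopeC.
set m := min_modulus g in m_pq.
have mP x y : e x <= e y -> m * mdist x y <= g y - g x.
  move=> xy; have [->|nxy] := eqVneq x y; first by rewrite mdistxx mulr0 subrr.
  rewrite -[leRHS]ger0_norm ?g_ge0// distrC -slopeM ler_wpM2r ?mdist_ge0//.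
  exact: min_modulus_le.
have m_ge0 : 0 <= m by rewrite -m_pq slope_ge0.
have mpqE : m * mdist p q = g q - g p.
  by rewrite -m_pq slopeM distrC ger0_norm// g_ge0// ltW.
(* Tested on the pair [x1], [y1], where [phi] has slope at most 2. *)
have m_le : m <= 2 * C + c / 2.
  have /andP[h1 h2] := ce1 _ _ (ltW xy1).
  have d0 : 0 < mdist x1 y1.
    by rewrite mdist_gt0; apply/eqP => xy; rewrite xy ltxx in xy1.
  rewrite -(ler_pM2r d0) (le_trans (mP _ _ (ltW xy1)))// (le_trans (gF2 _ _))//.
  by rewrite FE /=; lra.
have Ap z : range e (e z) by exists z.
have [_ [_ [[x _ <-] [y _ <-] /andP[px xy] yq phixy]]] := phi2 _ _ (Ap p) (Ap q) pq.
have d0 : 0 < mdist x y.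
  by rewrite mdist_gt0; apply/eqP => xy'; rewrite xy' ltxx in xy.
have /andP[h1 h2] := ce1 _ _ (ltW xy).
(* The increments of [g] along [p], [x], [y], [q] add up to [m * mdist p q]. The outer two are at
   least [m] times their distances, so the triangle inequality bounds the middle one from above. *)
have h3 : g y - g x <= m * mdist x y.
  have := mP _ _ px; have := mP _ _ yq.
  have : m * mdist p q <= m * (mdist p x + mdist x y + mdist y q).
    rewrite ler_wpM2l// (le_trans (metric_triangle p y q))// lerD2r.
    exact: metric_triangle.
  lra.
have h4 : K * c * mdist x y <= K * (e y - e x).
  by rewrite -mulrA ler_wpM2l//; lra.
have := gF1 x y; rewrite FE /= phixy; rewrite Kc in h4.
have : m * mdist x y <= (2 * C + c / 2) * mdist x y by rewrite ler_wpM2r// ltW.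
have : 0 < c * mdist x y by rewrite mulr_gt0.
lra.
Qed.

(** * Approximation when the range is a null set *)

Section null_range.
Context {R : realType} (M : completePointedMetricType R).
Context (f : Lip0 M) (c : R).
Context (c0 : 0 < c) (cf : forall p q, c * mdist p q <= `|f p - f q|).

Let f_inj : injective f.
Proof.
move=> p q fpq; apply/eqP; rewrite -[_ == _]negbK -mdist_gt0 -leNgt.
by rewrite -(ler_pM2l c0) mulr0 (le_trans (cf p q))// fpq subrr normr0.
Qed.

Let closed_f : closed (range f).
Proof. exact: closed_range_expanding cf (lip0_diff_le f). Qed.

Lemma exists_left_inverse : {h : R -> M | forall x, h (f x) = x}.
Proof.
exists (fun t => xget point [set x | f x = t]) => x; apply: f_inj.
by apply: (@xgetPex _ point [set y | f y = f x]); exists x.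
Qed.

(** The inverse of [f] on its closed range is Lipschitz with constant [c^-1], so the set is a
    continuous image of a closed part of a segment. *)
Lemma compact_preimage_itv a b : compact [set x | a <= f x <= b].
Proof.
have [h hE] := exists_left_inverse.
pose A := range f `&` `[a, b].
have -> : [set x | a <= f x <= b] = h @` A.
  apply/seteqP; split=> [x xab|_ [t [[x _ <-]] tab <-]].
    by exists (f x); rewrite ?hE//.
  by move: tab; rewrite hE /= in_itv.
apply: continuous_compact; last first.
  apply: subclosed_compact (@segment_compact _ a b) _; last exact: subIsetr.
  by apply: closedI => //; exact: interval_closed.
apply/subspace_continuousP => _ [[x _ <-] _].
apply/cvg_ballP => r r0; rewrite near_withinE /from_subspace hE.
apply/nbhs_ballP; exists (c * r); first by rewrite /= mulr_gt0.
move=> t /= fxt [[y _ yt] _]; rewrite -yt hE ballEmdist /= -(ltr_pM2l c0).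
by apply: le_lt_trans (cf x y) _; rewrite yt.
Qed.

Lemma slope_continuous (g : Lip0 M) (z : M * M) : z.1 != z.2 ->
  (fun z : M * M => slope g z.1 z.2) @ z --> slope g z.1 z.2.
Proof.
case: z => x y /= xy.
have cg : (fun z : M * M => g z.1 - g z.2) @ (x, y) --> g x - g y.
  apply/cvgrPdist_lt => r r0.
  have r1 : 0 < r / 2 / (`|g| + 1) by rewrite !divr_gt0// ltr_wpDl.
  exists (ball x (r / 2 / (`|g| + 1)), ball y (r / 2 / (`|g| + 1))).
    by split=> /=; exact: nbhsx_ballx.
  move=> [u v] /= []; rewrite !ballEmdist /= !ltr_pdivlMr ?ltr_wpDl// => xu yv.
  have := lip0_diff_le g x u; have := lip0_diff_le g y v.
  have := mdist_ge0 x u; have := mdist_ge0 y v.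
  have -> : g x - g y - (g u - g v) = (g x - g u) - (g y - g v) by ring.
  by have := ler_normB (g x - g u) (g y - g v); lra.
have cd : (fun z : M * M => mdist z.1 z.2) @ (x, y) --> mdist x y.
  apply/cvgrPdist_lt => r r0; have r1 : 0 < r / 2 by rewrite divr_gt0.
  exists (ball x (r / 2), ball y (r / 2)).
    by split=> /=; exact: nbhsx_ballx.
  move=> [u v] /= []; rewrite !ballEmdist /= => xu yv.
  have := mdist_diffl x u v; have := mdist_diffl y v x.
  rewrite !(metric_sym _ x) (metric_sym u v) (metric_sym v u) => h1 h2.
  have -> : mdist x y - mdist u v =
    (mdist x y - mdist x v) + (mdist x v - mdist u v) by ring.
  have := ler_normD (mdist x y - mdist x v) (mdist x v - mdist u v).
  lra.
apply: cvgM; first exact: cvg_norm.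
by apply: cvgV => //; rewrite gt_eqF// mdist_gt0.
Qed.

(** Otherwise the metric, carried to the range by a left inverse of [f], is at most
    [((1 + s) * m)^-1] times the length on every gap. As the range is null, [gap_estimate] extends
    this bound to all pairs, against a pair of slope below [(1 + s) * m]. *)
Lemma short_gap (s : R) : lebesgue_measure (range f) = 0%E ->
  (exists p q : M, p != q) -> 0 < s ->
  exists a b : M, is_gap (range f) (f a) (f b) /\
    f b - f a < (1 + s) * min_modulus f * mdist a b.
Proof.
move=> f0 [p0 [q0 pq0]] s0; apply: contrapT => nogap.
set m := min_modulus f.
have infS : has_inf (slopes f).
  by split; [exists (slope f p0 q0), (p0, q0)|exact: has_lbound_slopes].
have m0 : 0 < m.
  apply: (lt_le_trans c0); apply: lb_le_inf; first exact: infS.1.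
  by move=> _ [[x y] /= xy <-]; rewrite /slope ler_pdivlMr ?mdist_gt0.
have mP x y : m * mdist x y <= `|f x - f y|.
  have [->|xy] := eqVneq x y; first by rewrite mdistxx mulr0.
  by rewrite -slopeM ler_wpM2r ?mdist_ge0// min_modulus_le.
have ms0 : 0 < (1 + s) * m by rewrite mulr_gt0// addr_gt0.
have sm0 : 0 < s * m by rewrite mulr_gt0.
have [_ [[p q] /= pq <-] fpq] := inf_adherent sm0 infS.
wlog {pq} fpq_lt : p q pq fpq / f p < f q.
  move=> H; have : f p != f q by apply: contra_neq pq; exact: f_inj.
  rewrite neq_lt => /orP[|h]; first exact: H.
  by apply: (H q p) => //; rewrite ?(eq_sym q) ?(slopeC f q).
have d0 : 0 < mdist p q.
  by rewrite mdist_gt0; apply/eqP => epq; rewrite epq ltxx in fpq_lt.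
have [h hE] := exists_left_inverse.
have rf x : range f (f x) by exists x.
have mf : measurable (range f) by exact: closed_measurable.
have H := @gap_estimate _ _ (fun x y => mdist (h x) (h y)) ((1 + s) * m)^-1 m^-1
  _ _ closed_f (rf p) (rf q) (ltW fpq_lt).
have {H} : mdist (h (f p)) (h (f q)) <= ((1 + s) * m)^-1 * (f q - f p) +
    m^-1 * fine (lebesgue_measure (range f `&` `[f p, f q])).
  apply: H.
  - by rewrite invr_ge0 ltW.
  - by rewrite invr_ge0 ltW.
  - by move=> x y z _ _ _ _; exact: metric_triangle.
  - move=> _ _ [x _ <-] [y _ <-] xy; rewrite !hE ler_pdivlMl//.
    by rewrite (le_trans (mP x y))// distrC ger0_norm// subr_ge0.
  - move=> x y gxy; case: (gxy) => -[a _ ax] [b _ bx] _ _.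
    rewrite -ax -bx in gxy *; rewrite !hE ler_pdivlMl// leNgt.
    by apply/negP => lt_ab; apply: nogap; exists a, b.
have -> : lebesgue_measure (range f `&` `[f p, f q]) = 0%E.
  apply/eqP; rewrite eq_le measure_ge0 andbT.
  apply: (@le_trans _ _ (lebesgue_measure (range f))); last by rewrite f0.
  by apply: le_measure; rewrite ?inE//; exact: measurableI.
rewrite /= mulr0 addr0 !hE ler_pdivlMl// leNgt => /negP; apply.
move: fpq; rewrite /slope ltr_pdivrMr// distrC ger0_norm; last by rewrite subr_ge0 ltW.
by rewrite -/m; lra.
Qed.

Lemma SMA_approx_null (r : R) : lebesgue_measure (range f) = 0%E ->
  (exists p q : M, p != q) -> 0 < r ->
  exists2 g, SMA M g & `|f - g| <= r.
Proof.
move=> f0 M2 r0; set m := min_modulus f.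
have mP x y : m * mdist x y <= `|f x - f y|.
  have [->|xy] := eqVneq x y; first by rewrite mdistxx mulr0 subrr normr0.
  by rewrite -slopeM ler_wpM2r ?mdist_ge0// min_modulus_le.
(* [s <= 1 / 2] keeps [1 - s] and [1 - s ^+ 2] positive; [s * |f| <= r] makes the perturbation small
   enough. *)
have [s s0 [s1 sr]] : exists2 s, 0 < s & s <= 1 / 2 /\ s * `|f| <= r.
  have f1 : 0 < `|f| + 1 by rewrite ltr_wpDl.
  exists (Num.min (1 / 2) (r / (`|f| + 1))); first by rewrite lt_min !divr_gt0.
  split; first by rewrite ge_min lexx.
  apply: (@le_trans _ _ (r / (`|f| + 1) * (`|f| + 1))); last first.
    by rewrite divfK// gt_eqF.
  by apply: ler_pM; rewrite ?lerDl// ?le_min ?ge_min ?lexx ?orbT// !divr_ge0// ltW.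
have [a [b [[_ _ ab gab] abm]]] := short_gap f0 M2 s0; rewrite -/m in abm.
have d0 : 0 < mdist a b.
  by rewrite mdist_gt0; apply/eqP => eab; rewrite eab ltxx in ab.
have m_gt0 : 0 < m.
  have : 0 < (1 + s) * m * mdist a b by apply: lt_trans abm; rewrite subr_gt0.
  by rewrite pmulr_lgt0// pmulr_rgt0// addr_gt0.
(* Clamping to [[f a, f b]]: subtracting [s * k (f x)] shrinks the increment across the gap by the
   factor [1 - s] and changes no increment on either side of it. *)
pose k t := Num.max (f a) (Num.min t (f b)).
have kab t : t <= f a -> k t = f a.
  move=> ta; rewrite /k min_l ?max_l//; exact: le_trans ta (ltW ab).
have kba t : f b <= t -> k t = f b.
  by move=> tb; rewrite /k min_r ?max_r// ltW.
have k_lip t u : `|k t - k u| <= `|t - u|.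
  wlog tu : t u / t <= u.
    move=> H; have [|/ltW] := leP t u; first exact: H.
    by rewrite distrC (distrC t); exact: H.
  rewrite distrC (distrC t) (@ger0_norm _ (u - t)) ?subr_ge0// ler_norml.
  rewrite /k; case: (leP t (f b)) => tb; case: (leP u (f b)) => ub;
    case: (leP (f a) t) => ta; case: (leP (f a) u) => ua;
    rewrite ?(max_r (ltW ab)); lra.
have [p q|g gE] := @lip0_of_lipschitz _ M (fun x => f x - s * k (f x)) (`|f| + s * `|f|).
  rewrite opprD addrACA mulrDl (le_trans (ler_normD _ _))// lerD ?lip0_diff_le//.
  rewrite opprK addrC -mulrBr normrM (gtr0_norm s0) -mulrA ler_wpM2l ?(ltW s0)//.
  by rewrite (le_trans (k_lip _ _))// distrC lip0_diff_le.
exists g; last first.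
  apply: lip0_dist_le; first exact: ltW.
  move=> x y; rewrite gE.
  have -> : f x - f y - (f x - s * k (f x) - (f y - s * k (f y))) =
    s * (k (f x) - k (f y)) by ring.
  rewrite normrM (gtr0_norm s0).
  apply: le_trans (ler_wpM2r (mdist_ge0 _ _) sr); rewrite -mulrA ler_wpM2l ?(ltW s0)//.
  by rewrite (le_trans (k_lip _ _))// lip0_diff_le.
(* A pair across the gap loses [s * (f b - f a) = s ^+ 2 * B]. If its increment under [f] is at
   least [B], this is at most the share [s ^+ 2] of it. *)
pose B := (f b - f a) / s.
have B0 : 0 < B by rewrite divr_gt0// subr_gt0.
have sB : s * B = f b - f a by rewrite /B mulrC divfK// gt_eqF.
pose K := [set x | f a - B <= f x <= f a] `*` [set x | f b <= f x <= f b + B].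
have cK : compact K by apply: compact_setX; exact: compact_preimage_itv.
have Kab : K (a, b) by split; rewrite /= lexx ?andbT; lra.
have Kneq z : K z -> z.1 != z.2.
  move=> [/andP[_ h1] /andP[h2 _]]; apply/eqP => z12.
  rewrite z12 in h1; have := lt_le_trans ab (le_trans h2 h1).
  by rewrite ltxx.
have [||[x0 y0] /set_mem K0 Kmin] :=
  @compact_EVT_min _ R (fun z : M * M => slope g z.1 z.2) K _ cK.
- by exists (a, b).
- apply/subspace_continuousP => z /Kneq zn.
  by apply: cvg_within_filter; exact: slope_continuous.
have {}Kmin x y : K (x, y) -> slope g x0 y0 <= slope g x y.
  by move=> Kxy; exact: (Kmin (x, y) (mem_set Kxy)).
apply: (@strongly_attains_minP _ _ _ x0 y0); first exact: (Kneq (x0, y0)).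
(* The gap has slope below [(1 + s) * m] before the shrinking by [1 - s]. All slopes of [f] are at
   least [m], so a pair losing at most the share [s ^+ 2] cannot beat this value. *)
have min_le : slope g x0 y0 <= (1 - s ^+ 2) * m.
  apply: (le_trans (Kmin _ _ Kab)); rewrite /slope gE kab// kba// ler_pdivrMr//.
  have -> : f a - s * f a - (f b - s * f b) = - ((1 - s) * (f b - f a)) by ring.
  rewrite normrN ger0_norm; last by rewrite mulr_ge0 ?subr_ge0 ?(ltW ab)//; lra.
  have : (1 - s) * (f b - f a) <= (1 - s) * ((1 + s) * m * mdist a b).
    by rewrite ler_wpM2l ?subr_ge0 ?(ltW abm)//; lra.
  by move=> /le_trans; apply; rewrite le_eqVlt; apply/orP; left; apply/eqP; ring.
have s2 : 0 < s ^+ 2 by rewrite exprn_gt0.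
suff main x y : f x < f y -> slope g x0 y0 <= slope g x y.
  move=> x y xy; have : f x != f y by apply: contra_neq xy; exact: f_inj.
  by rewrite neq_lt => /orP[|h]; [exact: main|rewrite (slopeC g x); exact: main].
move=> xy; have dxy : 0 < mdist x y.
  by rewrite mdist_gt0; apply/eqP => exy; rewrite exy ltxx in xy.
have big_slope : (1 - s ^+ 2) * (f y - f x) <= g y - g x -> slope g x0 y0 <= slope g x y.
  move=> gxy; apply: (le_trans min_le); rewrite /slope ler_pdivlMr//.
  rewrite distrC (le_trans _ (ler_norm _))// (le_trans _ gxy)//.
  rewrite -mulrA ler_wpM2l//; first by nra.
  by have := mP x y; rewrite distrC ger0_norm// subr_ge0 ltW.
have gyx : g y - g x = f y - f x - s * (k (f y) - k (f x)).
  by rewrite gE; ring.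
have trivial_slope : k (f y) = k (f x) -> slope g x0 y0 <= slope g x y.
  by move=> kE; apply: big_slope; rewrite gyx kE; nra.
(* Pairs on one side of the gap lose nothing. All others straddle the gap, since no point of the
   range lies inside it; they either leave the window, and then have increment at least [B], or
   belong to [K]. *)
have [fya|fya] := leP (f y) (f a).
  by apply: trivial_slope; rewrite !kab// ltW// (lt_le_trans xy).
have [fxb|fxb] := leP (f b) (f x).
  by apply: trivial_slope; rewrite !kba// ltW// (le_lt_trans fxb).
have fxa : f x <= f a.
  by rewrite leNgt; apply/negP => h; apply: (gab (f x)); [exists x|rewrite h].
have fyb : f b <= f y.
  by rewrite leNgt; apply/negP => h; apply: (gab (f y)); [exists y|rewrite h fya].
have [xB|xB] := leP (f a - B) (f x); last first.
  by apply: big_slope; rewrite gyx kba// kab//; nra.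
have [yB|yB] := leP (f y) (f b + B); last first.
  by apply: big_slope; rewrite gyx kba// kab//; nra.
by apply: Kmin; split; rewrite /= ?xB ?yB ?fxa ?fyb.
Qed.

End null_range.

(** * One-dimensional Hausdorff measure under Lipschitz and expanding maps *)

Section hausdorff1_bilipschitz.
Context {R : realType} {M : metricType R}.
Local Open Scope ereal_scope.
Implicit Types (e : M -> R) (c C : R) (U : set M).

Lemma diam_ge0 U : 0 <= diam U.
Proof. by apply: ereal_sup_ubound; left. Qed.

Lemma mdist_le_diam U p q : U p -> U q -> (mdist p q)%:E <= diam U.
Proof. by move=> Up Uq; apply: ereal_sup_ubound; right; exists (p, q). Qed.

Lemma diam_le U (x : \bar R) : 0 <= x ->
  (forall p q, U p -> U q -> (mdist p q)%:E <= x) -> diam U <= x.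
Proof.
move=> x0 Ux; apply: ge_ereal_sup => _ [->//|[[p q] [/= Up Uq] <-]].
exact: Ux.
Qed.

(** Pulling back a cover of the range by intervals yields a cover of [M] whose diameters are at most
    [c^-1] times the lengths. *)
Lemma hausdorff1_expanding_eq0 e c : (0 < c)%R ->
  (forall p q, c * mdist p q <= `|e p - e q|)%R ->
  lebesgue_measure (range e) = 0 -> hausdorff1 [set: M] <= 0.
Proof.
move=> c0 ce e0; apply: ge_ereal_sup => _ [delta /= d0 <-].
apply/lee_addgt0Pr => eps eps0; rewrite add0e.
(* The first bound keeps each diameter below [delta], the second the sum of the diameters below
   [eps]. *)
pose eta := Num.min (c * delta)%R (c * eps)%R.
have eta0 : (0 < eta)%R by rewrite lt_min !mulr_gt0.
have : lebesgue_measure (range e) < eta%:E by rewrite e0 lte_fin.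
move=> /ereal_inf_lt[_ [F [mF eF] <-] Feta].
have W0 k : 0 <= wlength idfun (F k) by exact: wlength_ge0.
have Wle k : wlength idfun (F k) <= eta%:E.
  apply: le_trans (ltW Feta).
  rewrite (nneseriesD1 (n := k))//.
  by rewrite leeDl// nneseries_ge0.
have dF k : diam (e @^-1` F k) <= (c^-1)%:E * wlength idfun (F k).
  apply: diam_le; first by rewrite mule_ge0// lee_fin invr_ge0 ltW.
  move=> p q /= Fp Fq.
  have /ocitvP[F0|[[a b] /= ab FE]] := mF k; first by rewrite F0 in Fp.
  move: Fp Fq; rewrite FE.
  rewrite wlength_itv /= lte_fin ab !in_itv /= => /andP[aq qb] /andP[ap pb].
  rewrite -EFinB -EFinM lee_fin ler_pdivlMl// (le_trans (ce p q))//.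
  by rewrite ler_norml; lra.
apply: (@le_trans _ _ (\sum_(0 <= k <oo) diam (e @^-1` F k))).
  apply: ereal_inf_lbound; exists (fun k => e @^-1` F k) => //; split.
    by move=> p _; have [k _ Fk] := eF (e p) (ex_intro2 _ _ p I erefl); exists k.
  move=> k; apply: (le_trans (dF k)).
  apply: (@le_trans _ _ ((c^-1)%:E * eta%:E)).
    by rewrite lee_wpmul2l// lee_fin invr_ge0 ltW.
  by rewrite -EFinM lee_fin ler_pdivrMl// ge_min lexx.
apply: (@le_trans _ _ (\sum_(0 <= k <oo) ((c^-1)%:E * wlength idfun (F k)))).
  by apply: lee_nneseries => [k _ _|k _]; [exact: diam_ge0|].
rewrite nneseriesZl//.
apply: (@le_trans _ _ ((c^-1)%:E * eta%:E)).
  by rewrite lee_wpmul2l ?(ltW Feta)// lee_fin invr_ge0 ltW.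
by rewrite -EFinM lee_fin ler_pdivrMl// ge_min lexx orbT.
Qed.

(** A set of diameter [d] is mapped into an interval of length [2 * C * d] centred at the image of
    any of its points, so covers of [M] with small total diameter make the range null. *)
Lemma hausdorff1_lipschitz_gt0 e C : (0 < C)%R ->
  (forall p q, `|e p - e q| <= C * mdist p q)%R -> measurable (range e) ->
  0 < lebesgue_measure (range e) -> 0 < hausdorff1 [set: M].
Proof.
move=> C0 eC me e0; rewrite ltNge; apply/negP => H0.
(* One scale suffices; its bound 1 makes the diameters in the cover finite. *)
have H1 : hausdorff1_premeasure 1 [set: M] <= 0.
  by apply: le_trans H0; apply: ereal_sup_ubound; exists 1%R => /=.
move: e0; apply/negP; rewrite -leNgt; apply/lee_addgt0Pr => eps eps0; rewrite add0e.
have eta0 : (0 < eps / (2 * C))%R by rewrite divr_gt0// mulr_gt0.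
have /ereal_inf_lt[_ [U [UM U1] <-] Ueta] :
  hausdorff1_premeasure 1 [set: M] < (eps / (2 * C))%:E.
  by apply: (le_lt_trans H1); rewrite lte_fin.
have /choice[I IP] k : exists I : set R, [/\ measurable I, e @` U k `<=` I &
    lebesgue_measure I <= (2 * C)%:E * diam (U k)].
  have [->|/set0P[x Ux]] := eqVneq (U k) set0.
    exists set0; split=> //; first by rewrite image_set0.
    by rewrite measure0 mule_ge0 ?diam_ge0// lee_fin mulr_ge0// ltW.
  have fU : diam (U k) \is a fin_num.
    by rewrite ge0_fin_numE ?diam_ge0// (le_lt_trans (U1 k))// ltry.
  pose d := fine (diam (U k)).
  have dE : diam (U k) = d%:E by rewrite fineK.
  have d0 : (0 <= d)%R by rewrite fine_ge0// diam_ge0.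
  exists `[(e x - C * d)%R, (e x + C * d)%R]%classic; split=> //.
    move=> _ [y Uy <-]; rewrite /= in_itv /=.
    have : (mdist x y <= d)%R by rewrite -lee_fin -dE mdist_le_diam.
    rewrite -(ler_pM2l C0) => /(le_trans (eC x y)); rewrite ler_norml.
    by move=> /andP[h1 h2]; apply/andP; split; lra.
  rewrite lebesgue_measure_itv /= dE -EFinM; case: ifP => _.
    by rewrite -EFinB lee_fin; lra.
  by rewrite lee_fin !mulr_ge0// ltW.
have mI k : measurable (I k) by case: (IP k).
apply: (@le_trans _ _ (\sum_(0 <= k <oo) lebesgue_measure (I k))).
  apply: (measure_sigma_subadditive lebesgue_measure) => // _ [p _ <-].
  have [k _ Uk] := UM p Logic.I; exists k => //.
  by case: (IP k) => _ + _; apply; exists p.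
apply: (@le_trans _ _ (\sum_(0 <= k <oo) ((2 * C)%:E * diam (U k)))).
  by apply: lee_nneseries => [k _ _|k _]; [exact: measure_ge0|case: (IP k)].
rewrite nneseriesZl; last by move=> k _; exact: diam_ge0.
apply: (@le_trans _ _ ((2 * C)%:E * (eps / (2 * C))%:E)).
  by rewrite lee_wpmul2l ?(ltW Ueta)// lee_fin mulr_ge0// ltW.
by rewrite -EFinM lee_fin mulrC divfK// gt_eqF// mulr_gt0.
Qed.

End hausdorff1_bilipschitz.

(** * Assembling the equivalences *)

Lemma bilipschitz_embedding_expanding (R : realType) (M : pointedMetricType R)
    (f : Lip0 M) (c : R) : 0 < c ->
  (forall p q, c * mdist p q <= `|f p - f q|) -> bilipschitz_embedding f.
Proof.
(* The summand [c + 1] makes the upper constant strictly larger than [c]. *)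
move=> c0 cf; exists c, (`|f| + c + 1); split=> //.
  by rewrite addrAC ltrDr ltr_wpDl.
move=> p q; split=> //; apply: (le_trans (lip0_diff_le f p q)).
by rewrite ler_wpM2r ?mdist_ge0// -addrA lerDl addr_ge0// ltW.
Qed.

Lemma lebesgue_measurable_closed (R : realType) (A : set R) :
  closed A -> lebesgue_measurable A.
Proof. by move=> cA; apply: sub_caratheodory; exact: closed_measurable. Qed.

Unset Implicit Arguments.

Theorem theorem1 (R : realType) (M : completePointedMetricType R)
    (M_nontrivial : exists p q : M, p != q) :
  let a := ~ dense (SMA M) in
  let b := exists A : set R, [/\ lebesgue_measurable A,
    (0%:E < completed_lebesgue_measure A)%E & bilipschitz_equivalent M A] in
  let c := (exists f : Lip0 M, bilipschitz_embedding f) /\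
    (0%:E < hausdorff1 [set: M])%E in
  (a <-> b) /\ (b <-> c).
Proof.
move=> a b c.
(* The common route to (b), from (a) as well as from (c): completeness makes the range closed, hence
   measurable. *)
have bP (f : Lip0 M) k : 0 < k -> (forall p q, k * mdist p q <= `|f p - f q|) ->
    lebesgue_measure (range f) <> 0%E -> b.
  move=> k0 kf f0; exists (range f); split.
  - apply: lebesgue_measurable_closed.
    exact: closed_range_expanding kf (lip0_diff_le f).
  (* The completed measure and [lebesgue_measure] are the same set function up to conversion. *)
  - rewrite lt_neqAle; apply/andP; split; first by apply/eqP => /esym.
    exact: (measure_ge0 lebesgue_measure).
  - by exists f; split=> //; exact: bilipschitz_embedding_expanding kf.
split; split.
- move=> nd; apply: contrapT => nb; apply: nd => O [f Of] oO.
  have [r /= r0 rO] : exists2 r, 0 < r & ball f r `<=` O.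
    by apply/nbhs_ballP; exact: open_nbhs_nbhs.
  have r2 : 0 < r / 2 by rewrite divr_gt0.
  suff [g gS fg] : exists2 g, SMA M g & `|f - g| <= r / 2.
    exists g; split=> //; apply: rO; rewrite -ball_normE /=.
    by apply: (le_lt_trans fg); lra.
  (* Either [f] expands by [r / 2], and its range is null because (b) fails, or some slope of [f] is
     below [r / 2]. *)
  have [rf|/existsNP[p /existsNP[q /negP]]] :=
    pselect (forall p q, r / 2 * mdist p q <= `|f p - f q|).
    apply: (SMA_approx_null r2 rf) => //.
    by apply: contrapT => f0; apply: nb; exact: bP rf f0.
  rewrite -ltNge => fpq; have pq : p != q.
    by apply/eqP => pq; move: fpq; rewrite pq mdistxx mulr0 ltNge normr_ge0.
  apply: (SMA_approx_small_slope pq).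
  by rewrite /slope ler_pdivrMr ?mdist_gt0// ltW.
- move=> [A [_ A0 [f [[k [K [k0 kK kf]]] fA]]]].
  apply: (@not_dense_SMA R M f k K k0 (ltW kK)).
  + by move=> p q; case: (kf p q).
  + by move=> p q; case: (kf p q).
  + by rewrite fA.
- move=> [A [_ A0 [f [[k [K [k0 kK kf]]] fA]]]]; split.
    by exists f, k, K.
  apply: (@hausdorff1_lipschitz_gt0 R M f K); first exact: lt_trans kK.
  + by move=> p q; case: (kf p q).
  + apply: closed_measurable; apply: (closed_range_expanding k0 _ (lip0_diff_le f)).
    by move=> p q; case: (kf p q).
  + by rewrite fA.
- move=> [[f [k [K [k0 _ kf]]]] H0].
  have kf' p q : k * mdist p q <= `|f p - f q| by case: (kf p q).
  apply: (bP f k) => // f0; have := hausdorff1_expanding_eq0 k0 kf' f0.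
  by rewrite leNgt H0.
Qed.
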